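(* For each $c>0$ the set $\Omega(c)=\{\bar\xi\in\Omega : E(\bar\xi)\le c\}$ is compact. In particular, the function $E$ attains its minimal value on $\Omega$.
   Context: Data: an integer $m\ge 1$; real numbers $u_0\le u_1<u_2<\cdots<u_m<u_{m+1}=u_D$; constants $a_i>0$, $k_i>0$ ($i=0,\ldots,m$) and $d_i\ge 0$ ($i=1,\ldots,m$), with $d_1>0$ if $u_0=u_1$. Put $F(\xi)=\frac{1}{\sqrt{\pi}}\int_0^\xi e^{-s^2/4}\,ds$, with $F(+\infty)=1$. Let $\Omega=\{\bar\xi=(\xi_1,\ldots,\xi_m)\in\mathbb{R}^m : \xi_1>\cdots>\xi_m>0\}$ and, with the conventions $\xi_0=+\infty$, $\xi_{m+1}=0$, $$E(\bar\xi)=-\sum_{i=0}^m k_i(u_{i+1}-u_i)\ln\bigl(F(\xi_i/a_i)-F(\xi_{i+1}/a_i)\bigr)+\sum_{i=1}^m \frac{d_i\xi_i^2}{4},\qquad \bar\xi\in\Omega.$$ *)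

(* Defs.v *)
From HB Require Import structures.
From mathcomp Require Import all_boot all_order all_algebra.
From mathcomp Require Import all_classical all_reals all_analysis.
Set Implicit Arguments.
Unset Strict Implicit.
Unset Printing Implicit Defensive.
Import Order.TTheory GRing.Theory Num.Theory.
Import numFieldNormedType.Exports.
Local Open Scope classical_set_scope.
Local Open Scope ring_scope.

(* The oriented integral of exp(-s^2/4) from 0 to xi, divided by sqrt(pi). *)
Definition Freal (R : realType) (xi : R) : R :=
  (Num.sqrt pi)^-1 *
  (if 0 <= xi
   then (\int[lebesgue_measure]_(s in `[0%R, xi]) expR (- (s ^+ 2 / 4)))%R
   else - (\int[lebesgue_measure]_(s in `[xi, 0%R]) expR (- (s ^+ 2 / 4)))%R).

(* The value at -oo is never used; it is the limit of Freal there. *)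
Definition F (R : realType) (xi : \bar R) : R :=
  match xi with
  | r%:E => Freal r
  | +oo%E => 1
  | -oo%E => -1
  end.

(* A row vector x of size m is (xi_1, ..., xi_m), with xi_i = x 0 (i - 1);
   [xi_ext x i] is xi_i for every 0 <= i <= m + 1, including the conventions
   xi_0 = +oo and xi_(m+1) = 0. *)
Definition xi_ext (R : realType) (m : nat) (x : 'rV[R]_m) (i : nat) : \bar R :=
  match i with
  | 0%N => +oo%E
  | j.+1 => if insub j is Some j' then (x 0 j')%:E else 0%E
  end.

Definition Omega (R : realType) (m : nat) : set 'rV[R]_m :=
  [set x | (forall i j : 'I_m, (i < j)%N -> x 0 j < x 0 i) /\
           (forall i : 'I_m, 0 < x 0 i)].

(* In the second sum, i : 'I_m stands for the index i + 1 in {1, ..., m}. *)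
Definition E (R : realType) (m : nat) (u a k d : nat -> R) (x : 'rV[R]_m) : R :=
  - (\sum_(0 <= i < m.+1) k i * (u i.+1 - u i) *
       ln (F (xi_ext x i * ((a i)^-1)%:E)%E -
           F (xi_ext x i.+1 * ((a i)^-1)%:E)%E))
  + \sum_(i < m) d i.+1 * x 0 i ^+ 2 / 4.

Definition Omega_le (R : realType) (m : nat) (u a k d : nat -> R) (c : R) :
    set 'rV[R]_m :=
  [set x | Omega x /\ E u a k d x <= c].

(* Main.v *)
Require Import Defs.
From HB Require Import structures.
From mathcomp Require Import all_boot all_order all_algebra.
From mathcomp Require Import all_classical all_reals all_analysis.
Import Order.TTheory GRing.Theory Num.Theory.
Import numFieldNormedType.Exports.
Local Open Scope classical_set_scope.
Local Open Scope ring_scope.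

(** Every summand of [E] is nonnegative on [Omega]: the differences
    F(xi_i / a_i) - F(xi_(i+1) / a_i), called gaps below, lie in (0, 1], so
    their logarithms are nonpositive, and the quadratic terms are nonnegative.
    A bound E(xi) <= c therefore bounds each summand by c separately, and keeps
    xi away from every part of the boundary of [Omega].

    - For 1 <= i <= m the weight k_i (u_(i+1) - u_i) is positive, so the i-th
      gap is at least a positive constant ([gap_ge]).  The integrand of [F] is
      at most 1, hence F is Lipschitz on the half-line, and a lower bound on
      the gap gives a lower bound xi_i - xi_(i+1) >= delta_i > 0
      ([gap_le_xi_finB]).  The latter conditions are closed and linear in xi,
      and they imply that xi is in [Omega].
    - The largest coordinate xi_1 is bounded above ([xi_fin0_bounded]).  If
      u_0 < u_1, the term of index 0 bounds 1 - F(xi_1 / a_0) from below, and F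
      tends to 1 at infinity by the Gaussian integral ([Freal_cvg1]); if
      u_0 = u_1, then d_1 > 0 and the term d_1 xi_1^2 / 4 gives the bound.

    So the sublevel set is contained in a box, and it is the sublevel set of
    [E] on a closed subset of [Omega], on which [E] is continuous; it is closed
    and bounded, hence compact.  A minimizer on the nonempty sublevel set
    through any point of [Omega] is a global one. *)

(** * The error function F *)

Definition heat_kernel {R : realType} (s : R) : R := expR (- (s ^+ 2 / 4)).

Lemma continuous_heat_kernel (R : realType) : continuous (@heat_kernel R).
Proof.
move=> s; apply: continuous_comp; last exact: continuous_expR.
apply: cvgN; apply: cvgM; last exact: cvg_cst.
exact: exprn_continuous.
Qed.

Lemma heat_kernel_le1 (R : realType) (s : R) : heat_kernel s <= 1.
Proof. by rewrite -expR0 ler_expR oppr_le0 divr_ge0// sqr_ge0. Qed.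

Lemma continuous_integrable_itv (R : realType) (g : R -> R) (i : interval R)
    (x y : R) : continuous g -> [set` i] `<=` `[x, y] ->
  (@lebesgue_measure R).-integrable [set` i] (EFin \o g).
Proof.
move=> cg ixy; apply: (integrableS (mu := @lebesgue_measure R) _ _ ixy) => //.
apply: continuous_compact_integrable; first exact: segment_compact.
exact: continuous_subspaceT.
Qed.

Lemma FrealE (R : realType) (x : R) : 0 <= x -> Freal x =
  (Num.sqrt pi)^-1 * \int[lebesgue_measure]_(s in `[0%R, x]) heat_kernel s.
Proof. by move=> x0; rewrite /Freal x0. Qed.

Lemma Freal0 (R : realType) : Freal (0 : R) = 0.
Proof. by rewrite FrealE// set_itv1 Rintegral_set1 mulr0. Qed.

Lemma Freal_ge0 (R : realType) (x : R) : 0 <= x -> 0 <= Freal x.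
Proof.
move=> x0; rewrite FrealE// mulr_ge0 ?invr_ge0 ?sqrtr_ge0//.
by apply: Rintegral_ge0 => s _; exact: expR_ge0.
Qed.

Lemma FrealB (R : realType) (x y : R) : 0 <= x -> x <= y ->
  Freal y - Freal x =
  (Num.sqrt pi)^-1 * \int[lebesgue_measure]_(s in `]x, y]) heat_kernel s.
Proof.
move=> x0 xy; rewrite !FrealE ?(le_trans x0 xy)// -mulrBr.
rewrite Rintegral_itvB ?bnd_simp//.
by apply: (@continuous_integrable_itv _ _ _ 0 y) => //;
  exact: continuous_heat_kernel.
Qed.

Lemma Rintegral_cst_itv (R : realType) (x y r : R) : x <= y ->
  \int[@lebesgue_measure R]_(s in `]x, y]) (fun=> r) s = r * (y - x).
Proof.
move=> xy; rewrite Rintegral_cst//= lebesgue_measure_itv/= lte_fin.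
have [//|yx] := ltP x y.
by rewrite (@le_anti _ _ y x) ?subrr// yx xy.
Qed.

(** On [x, y] the integrand is at least its value at y, which is positive. *)
Lemma Freal_lt (R : realType) (x y : R) : 0 <= x -> x < y -> Freal x < Freal y.
Proof.
move=> x0 xy; rewrite -subr_gt0 FrealB ?(ltW xy)//.
rewrite mulr_gt0 ?invr_gt0 ?sqrtr_gt0 ?pi_gt0//.
apply: (@lt_le_trans _ _ (heat_kernel y * (y - x))).
  by rewrite mulr_gt0 ?expR_gt0 ?subr_gt0.
rewrite -Rintegral_cst_itv ?(ltW xy)//; apply: le_Rintegral => //.
- by apply: (@continuous_integrable_itv _ _ _ x y);
    [exact: cst_continuous|exact: subset_itv_oc_cc].
- by apply: (@continuous_integrable_itv _ _ _ x y);
    [exact: continuous_heat_kernel|exact: subset_itv_oc_cc].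
- move=> s /=; rewrite in_itv/= => /andP[xs sy].
  have s0 := ltW (le_lt_trans x0 xs).
  by rewrite ler_expR lerN2 ler_pM2r// lerXn2r// nnegrE (le_trans s0 sy).
Qed.

Lemma Freal_lip (R : realType) (x y : R) : 0 <= x -> x <= y ->
  Freal y - Freal x <= (Num.sqrt pi)^-1 * (y - x).
Proof.
move=> x0 xy; rewrite FrealB// ler_pM2l ?invr_gt0 ?sqrtr_gt0 ?pi_gt0//.
rewrite -[leRHS]mul1r -Rintegral_cst_itv//; apply: le_Rintegral => //.
- by apply: (@continuous_integrable_itv _ _ _ x y);
    [exact: continuous_heat_kernel|exact: subset_itv_oc_cc].
- by apply: (@continuous_integrable_itv _ _ _ x y);
    [exact: cst_continuous|exact: subset_itv_oc_cc].
- by move=> s _; exact: heat_kernel_le1.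
Qed.

Lemma Freal_continuous (R : realType) (x : R) : 0 < x ->
  {for x, continuous (@Freal R)}.
Proof.
move=> x0; apply/cvgrPdist_le => /= e e0.
have s0 : 0 < Num.sqrt pi :> R by rewrite sqrtr_gt0 pi_gt0.
near=> y.
have y0 : 0 < y by near: y; exact: lt_nbhsr.
have d0 : `|x - y| <= Num.sqrt pi * e.
  by near: y; apply: cvgr_dist_le; rewrite ?mulr_gt0.
apply: (@le_trans _ _ ((Num.sqrt pi)^-1 * `|x - y|)); last first.
  by rewrite ler_pdivrMl.
have [xy|yx] := leP x y.
  rewrite distrC (distrC x) !ger0_norm ?subr_ge0//.
    by apply: Freal_lip => //; exact: ltW.
  move: xy; rewrite le_eqVlt => /predU1P[->//|].
  by move=> /(Freal_lt _ _ _ (ltW x0))/ltW.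
rewrite !ger0_norm ?subr_ge0 ?(ltW yx)//.
  by apply: Freal_lip => //; exact: ltW.
by rewrite ltW// Freal_lt// ltW.
Unshelve. all: by end_near. Qed.

(** The substitution s = 2 t turns exp(- s^2 / 4) into exp(- t^2). *)
Lemma Freal_double (R : realType) (x : R) : 0 <= x ->
  Freal (2 * x) =
  2 * (Num.sqrt pi)^-1 * gauss_integral_proof.integral0_gauss x.
Proof.
move=> x0; rewrite FrealE ?mulr_ge0// [2 * _ in RHS]mulrC -mulrA; congr (_ * _).
have der : derive1 (fun t : R => 2 * t) = cst 2.
  by apply/funext => z; rewrite derive1Ml// derive1_id mulr1.
transitivity
  (\int[lebesgue_measure]_(t in `[0%R, x]) (heat_kernel (2 * t) * 2)).
  congr fine.
  have := @integration_by_substitution_increasing R (fun t => 2 * t)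
    heat_kernel 0 x x0.
  rewrite mulr0 => subst; rewrite [LHS]subst; first by rewrite der.
  - by move=> a b _ _ ab; rewrite ltr_pM2l.
  - by rewrite der => z _; exact: cvg_cst.
  - by rewrite der; exact: is_cvg_cst.
  - by rewrite der; exact: is_cvg_cst.
  - split => //.
    + by apply: cvg_at_right_filter; apply: cvgM => //; exact: cvg_cst.
    + by apply: cvg_at_left_filter; apply: cvgM => //; exact: cvg_cst.
  - by apply: continuous_subspaceT; exact: continuous_heat_kernel.
rewrite RintegralZr//; last first.
  apply: (@continuous_integrable_itv _ _ _ 0 x) => // z; apply: continuous_comp.
    by apply: cvgM; [exact: cvg_cst|exact: cvg_id].
  exact: continuous_heat_kernel.
rewrite mulrC; congr (_ * _); apply: eq_Rintegral => t _.
by rewrite /heat_kernel /gauss_fun exprMn mulrAC -natrX divff ?mul1r//.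
Qed.

(** The Gaussian integral: the square of the integral of exp(- t^2) over [0, x]
    tends to pi / 4.  Since [Freal] is nonnegative and increasing on the
    half-line, its square carries all that is needed about its limit. *)
Lemma Freal_cvg1 (R : realType) : (Freal x ^+ 2 : R) @[x --> +oo%R] --> (1 : R).
Proof.
have half : (x / 2 : R) @[x --> +oo%R] --> +oo%R.
  by apply: gt0_cvgMly; [rewrite invr_gt0|exact: cvg_id].
have := cvg_comp _ _ half (@gauss_integral_proof.cvg_integral0_gauss_sqr R).
move=> /(cvgM (cvg_cst (4 / pi : R))) /=.
rewrite (_ : 4 / pi * (pi / 4) = 1); last first.
  by rewrite mulrA divfK ?divff// gt_eqF// pi_gt0.
move=> h.
apply: cvg_trans h; apply: near_eq_cvg; near=> x => /=.
have x0 : 0 <= x by near: x; apply: nbhs_pinfty_ge; rewrite num_real.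
rewrite -[in RHS](divfK (_ : 2 != 0) x)// [_ * 2]mulrC Freal_double ?divr_ge0//.
by rewrite !exprMn exprVn sqr_sqrtr ?pi_ge0// -natrX.
Unshelve. all: by end_near. Qed.

(** F(x) < F(x + 1), and an increasing function is at most its limit. *)
Lemma Freal_lt1 (R : realType) (x : R) : 0 <= x -> Freal x < 1.
Proof.
move=> x0; apply: (@lt_le_trans _ _ (Freal (x + 1))).
  by apply: Freal_lt => //; rewrite ltrDl.
have x10 : 0 <= x + 1 by rewrite addr_ge0.
rewrite -(@ler_pXn2r _ 2) ?nnegrE ?Freal_ge0// expr1n.
apply: (cvgr_to_ge (Freal_cvg1 R)); near=> y.
have xy : x + 1 < y by near: y; apply: nbhs_pinfty_gt; rewrite num_real.
have y0 := le_trans x10 (ltW xy).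
by rewrite ler_pXn2r ?nnegrE ?Freal_ge0// ltW// Freal_lt.
Unshelve. all: by end_near. Qed.

(** Choose M with F(M) > 1 - e, by the limit at infinity; beyond M, F is even
    larger. *)
Lemma Freal_bounded_preimage (R : realType) (e : R) : 0 < e ->
  exists2 M : R, 0 <= M & forall x, 0 <= x -> e <= 1 - Freal x -> x <= M.
Proof.
move=> e0; have e1 : 1 - e < 1 by rewrite gtrBl.
suff [M M0 FM] : exists2 M : R, 0 <= M & 1 - e < Freal M.
  exists M => // x x0 ex; rewrite leNgt; apply/negP => /(Freal_lt _ _ _ M0).
  by move=> /(lt_trans FM); apply/negP; rewrite -leNgt lerBrDr addrC -lerBrDr.
have [e_ge1|e_lt1] := ltP 1 e.
  by exists 0 => //; rewrite Freal0 subr_lt0.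
have e_ge0 : 0 <= 1 - e by rewrite subr_ge0.
have : (1 - e) ^+ 2 < 1 by rewrite expr_lt1.
move=> /(cvgr_gt _ (Freal_cvg1 R)) near_gt.
have [M [M0 FM]] : exists M : R, 0 <= M /\ (1 - e) ^+ 2 < Freal M ^+ 2.
  apply: (@filter_ex _ (pinfty_nbhs R)); near=> M; split.
    by near: M; apply: nbhs_pinfty_ge; rewrite num_real.
  by near: M.
by exists M => //; rewrite -(@ltr_pXn2r _ 2)// nnegrE Freal_ge0.
Unshelve. all: by end_near. Qed.

(** * Coordinates and gaps *)

(** The real number xi_(i+1), for every i : nat.  The default value 0 realizes
    the convention xi_(m+1) = 0 and makes the inequalities that define [Omega]
    uniform in i. *)
Definition xi_fin {R : realType} {m : nat} (x : 'rV[R]_m) (i : nat) : R :=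
  if insub i is Some j then x 0 j else 0.

Lemma xi_fin_ord (R : realType) (m : nat) (x : 'rV[R]_m) (i : 'I_m) :
  xi_fin x i = x 0 i.
Proof. by rewrite /xi_fin valK. Qed.

Lemma xi_fin_out (R : realType) (m : nat) (x : 'rV[R]_m) (i : nat) :
  (m <= i)%N -> xi_fin x i = 0.
Proof. by move=> mi; rewrite /xi_fin insubF// ltnNge mi. Qed.

Lemma xi_extS (R : realType) (m : nat) (x : 'rV[R]_m) (i : nat) :
  xi_ext x i.+1 = (xi_fin x i)%:E.
Proof. by rewrite /xi_ext /xi_fin; case: insubP. Qed.

Lemma continuous_xi_fin (R : realType) (m : nat) (i : nat) :
  continuous (fun x : 'rV[R]_m => xi_fin x i).
Proof.
rewrite /xi_fin; case: insubP => [j _ _|_] x; first exact: coord_continuous.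
exact: cst_continuous.
Qed.

Lemma Omega_xi_fin_gt0 (R : realType) (m : nat) (x : 'rV[R]_m) (i : nat) :
  Omega x -> (i < m)%N -> 0 < xi_fin x i.
Proof. by move=> [_ x0] im; rewrite (xi_fin_ord _ _ _ (Ordinal im)). Qed.

Lemma Omega_xi_fin_ge0 (R : realType) (m : nat) (x : 'rV[R]_m) (i : nat) :
  Omega x -> 0 <= xi_fin x i.
Proof.
move=> Ox; have [mi|im] := leqP m i; first by rewrite xi_fin_out.
exact/ltW/Omega_xi_fin_gt0.
Qed.

(** Comparing neighbours is enough, the last neighbour being xi_(m+1) = 0; this
    includes positivity. *)
Lemma OmegaP (R : realType) (m : nat) (x : 'rV[R]_m) :
  Omega x <-> (forall i, (i < m)%N -> xi_fin x i.+1 < xi_fin x i).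
Proof.
split=> [Ox i im|xlt].
  have [mi|im1] := leqP m i.+1.
    by rewrite (xi_fin_out _ _ _ i.+1)//; exact: Omega_xi_fin_gt0.
  rewrite (xi_fin_ord _ _ _ (Ordinal im)) (xi_fin_ord _ _ _ (Ordinal im1)).
  by apply: Ox.1.
have lt_xi i j : (i < j <= m)%N -> xi_fin x j < xi_fin x i.
  elim: j => // j IH /andP[]; rewrite ltnS leq_eqVlt => /predU1P[->|ij] jm.
    exact: xlt.
  by apply: (lt_trans (xlt _ jm)); apply: IH; rewrite ij ltnW.
split=> [i j ij|i].
  by rewrite -!xi_fin_ord; apply: lt_xi; rewrite ij ltnW.
rewrite -xi_fin_ord -(xi_fin_out _ _ x m (leqnn m)); apply: lt_xi.
by rewrite ltn_ord/=.
Qed.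

(** The argument of the i-th logarithm of [E]. *)
Definition gap {R : realType} {m : nat} (a : nat -> R) (x : 'rV[R]_m)
    (i : nat) : R :=
  F (xi_ext x i * ((a i)^-1)%:E)%E - F (xi_ext x i.+1 * ((a i)^-1)%:E)%E.

Lemma gap0E (R : realType) (m : nat) (a : nat -> R) (x : 'rV[R]_m) :
  0 < a 0%N -> gap a x 0 = 1 - Freal (xi_fin x 0 / a 0%N).
Proof.
by move=> a0; rewrite /gap xi_extS gt0_mulye// lte_fin invr_gt0.
Qed.

Lemma gapSE (R : realType) (m : nat) (a : nat -> R) (x : 'rV[R]_m) (i : nat) :
  gap a x i.+1 =
  Freal (xi_fin x i / a i.+1) - Freal (xi_fin x i.+1 / a i.+1).
Proof. by rewrite /gap !xi_extS. Qed.

Lemma gap_gt0 (R : realType) (m : nat) (a : nat -> R) (x : 'rV[R]_m) (i : nat) :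
  Omega x -> (i <= m)%N -> 0 < a i -> 0 < gap a x i.
Proof.
move=> Ox; case: i => [|i] im ai.
  rewrite gap0E// subr_gt0 Freal_lt1// divr_ge0 ?(ltW ai)//.
  exact: Omega_xi_fin_ge0.
rewrite gapSE subr_gt0 Freal_lt//.
  by rewrite divr_ge0 ?(ltW ai)// Omega_xi_fin_ge0.
by rewrite ltr_pM2r ?invr_gt0//; move/OmegaP : Ox; exact.
Qed.

Lemma gap_le1 (R : realType) (m : nat) (a : nat -> R) (x : 'rV[R]_m) (i : nat) :
  Omega x -> 0 < a i -> gap a x i <= 1.
Proof.
move=> Ox; case: i => [|i] ai.
  by rewrite gap0E// gerBl Freal_ge0// divr_ge0 ?(ltW ai)// Omega_xi_fin_ge0.
have ge0 j : 0 <= xi_fin x j / a i.+1.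
  by rewrite divr_ge0 ?(ltW ai)// Omega_xi_fin_ge0.
rewrite gapSE lerBlDr (le_trans (ltW (Freal_lt1 _ _ (ge0 i))))//.
by rewrite lerDl Freal_ge0.
Qed.

(** The Lipschitz bound on F turns a lower bound on a gap into a lower bound
    on a difference of coordinates, which is a closed condition. *)
Lemma gap_le_xi_finB (R : realType) (m : nat) (a : nat -> R) (x : 'rV[R]_m)
    (i : nat) : Omega x -> (i < m)%N -> 0 < a i.+1 ->
  Num.sqrt pi * a i.+1 * gap a x i.+1 <= xi_fin x i - xi_fin x i.+1.
Proof.
move=> Ox im ai; rewrite gapSE mulrAC -ler_pdivlMr// mulrBl.
rewrite -ler_pdivlMl ?sqrtr_gt0 ?pi_gt0//; apply: Freal_lip.
  by rewrite divr_ge0 ?(ltW ai)// Omega_xi_fin_ge0.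
rewrite ler_pM2r ?invr_gt0//; apply/ltW.
by move/OmegaP : Ox; exact.
Qed.

(** Continuity of [Freal] at positive points suffices, because the one
    coordinate that vanishes, xi_(m+1), is constant. *)
Lemma continuous_gap (R : realType) (m : nat) (a : nat -> R) (x : 'rV[R]_m)
    (i : nat) : Omega x -> (i <= m)%N -> 0 < a i ->
  {for x, continuous (fun y => gap a y i)}.
Proof.
move=> Ox im ai.
have cF j : {for x, continuous (fun y => Freal (xi_fin y j / a i))}.
  have [mj|jm] := leqP m j.
    rewrite (_ : (fun _ => _) = cst (Freal 0)); first exact: cst_continuous.
    by apply/funext => y; rewrite xi_fin_out// mul0r.
  apply: (@continuous_comp _ _ _ (fun y => xi_fin y j / a i) (@Freal R)).
    by apply: continuousM; [exact: continuous_xi_fin|exact: cst_continuous].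
  by apply: Freal_continuous; rewrite divr_gt0// Omega_xi_fin_gt0.
case: i im ai cF => [|i] im ai cF.
  rewrite (_ : (fun _ => _) = (fun y => 1 - Freal (xi_fin y 0 / a 0%N))).
    by apply: continuousB; [exact: cst_continuous|exact: cF].
  by apply/funext => y; rewrite gap0E.
rewrite (_ : (fun _ => _) = (fun y => Freal (xi_fin y i / a i.+1) -
  Freal (xi_fin y i.+1 / a i.+1))); first by apply: continuousB; exact: cF.
by apply/funext => y; rewrite gapSE.
Qed.

(** * The summands of E *)

Lemma E_sum (R : realType) (m : nat) (u a k d : nat -> R) (x : 'rV[R]_m) :
  E u a k d x =
  \sum_(i < m.+1) k i * (u i.+1 - u i) * - ln (gap a x i) +
  \sum_(i < m) d i.+1 * x 0 i ^+ 2 / 4.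
Proof.
rewrite /E big_mkord -sumrN; congr (_ + _).
by apply: eq_bigr => i _; rewrite mulrN.
Qed.

Lemma ler_sum_term (R : realType) (n : nat) (f : 'I_n -> R) (i : 'I_n) :
  (forall j, 0 <= f j) -> f i <= \sum_(j < n) f j.
Proof. by move=> f0; rewrite (bigD1 i)//= lerDl sumr_ge0. Qed.

Lemma barrier_ge0 (R : realType) (m : nat) (a : nat -> R) (x : 'rV[R]_m)
    (i : nat) : Omega x -> 0 < a i -> 0 <= - ln (gap a x i).
Proof. by move=> Ox ai; rewrite oppr_ge0 ln_le0// gap_le1. Qed.

Lemma barrier_le_E (R : realType) (m : nat) (u a k d : nat -> R)
    (x : 'rV[R]_m) (i : nat) :
  (forall j, (j <= m)%N -> 0 < a j) ->
  (forall j, (j <= m)%N -> 0 <= k j * (u j.+1 - u j)) ->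
  (forall j, (1 <= j <= m)%N -> 0 <= d j) ->
  Omega x -> (i <= m)%N ->
  k i * (u i.+1 - u i) * - ln (gap a x i) <= E u a k d x.
Proof.
move=> ha hw hd Ox im; rewrite E_sum -[leLHS]addr0 lerD//.
  have := @ler_sum_term R m.+1
    (fun j => k j * (u j.+1 - u j) * - ln (gap a x j)) (inord i).
  rewrite inordK//; apply => j; have jm : (j <= m)%N by rewrite -ltnS.
  by rewrite mulr_ge0 ?hw// barrier_ge0 ?ha.
by apply: sumr_ge0 => j _; rewrite divr_ge0// mulr_ge0 ?sqr_ge0 ?hd/=.
Qed.

Lemma quadratic_le_E (R : realType) (m : nat) (u a k d : nat -> R)
    (x : 'rV[R]_m) (i : nat) :
  (forall j, (j <= m)%N -> 0 < a j) ->
  (forall j, (j <= m)%N -> 0 <= k j * (u j.+1 - u j)) ->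
  (forall j, (1 <= j <= m)%N -> 0 <= d j) ->
  Omega x -> (i < m)%N ->
  d i.+1 * xi_fin x i ^+ 2 / 4 <= E u a k d x.
Proof.
move=> ha hw hd Ox im; rewrite E_sum -[leLHS]add0r lerD//.
  apply: sumr_ge0 => j _; have jm : (j <= m)%N by rewrite -ltnS.
  by rewrite mulr_ge0 ?hw// barrier_ge0 ?ha.
rewrite (xi_fin_ord _ _ _ (Ordinal im)).
apply: (@ler_sum_term R m (fun j => d j.+1 * x 0 j ^+ 2 / 4) (Ordinal im)) => j.
by rewrite divr_ge0// mulr_ge0 ?sqr_ge0 ?hd/=.
Qed.

(** All other summands of [E] being nonnegative, the i-th weighted logarithm
    alone is at most c. *)
Lemma gap_ge (R : realType) (m : nat) (u a k d : nat -> R) (c : R)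
    (x : 'rV[R]_m) (i : nat) :
  (forall j, (j <= m)%N -> 0 < a j) ->
  (forall j, (j <= m)%N -> 0 <= k j * (u j.+1 - u j)) ->
  (forall j, (1 <= j <= m)%N -> 0 <= d j) ->
  Omega_le u a k d c x -> (i <= m)%N -> 0 < k i * (u i.+1 - u i) ->
  expR (- (c / (k i * (u i.+1 - u i)))) <= gap a x i.
Proof.
move=> ha hw hd [Ox Ec] im wi.
have g0 := gap_gt0 _ _ _ _ _ Ox im (ha _ im).
rewrite -[leRHS]lnK// ler_expR lerNl ler_pdivlMr// mulrC.
by rewrite (le_trans _ Ec)// barrier_le_E.
Qed.

Lemma continuous_sum_at (R : realType) (T : topologicalType) (n : nat)
    (f : 'I_n -> T -> R) (x : T) : (forall i, {for x, continuous (f i)}) ->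
  {for x, continuous (fun y => \sum_(i < n) f i y)}.
Proof.
move=> cf; apply: cvg_big => [|i _]; [exact: add_continuous|exact: cf].
Qed.

Lemma continuous_E (R : realType) (m : nat) (u a k d : nat -> R)
    (x : 'rV[R]_m) : (forall j, (j <= m)%N -> 0 < a j) -> Omega x ->
  {for x, continuous (E u a k d)}.
Proof.
move=> ha Ox; rewrite (_ : E u a k d = fun y =>
  \sum_(i < m.+1) k i * (u i.+1 - u i) * - ln (gap a y i) +
  \sum_(i < m) d i.+1 * y 0 i ^+ 2 / 4); last first.
  by apply/funext => y; rewrite E_sum.
apply: continuousD; apply: continuous_sum_at => i.
  have im : (i <= m)%N by rewrite -ltnS.
  apply: continuousM; first exact: cst_continuous.
  apply: continuousN; apply: (@continuous_comp _ _ _ (fun y => gap a y i)).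
    exact/continuous_gap/ha.
  by apply: continuous_ln; rewrite gap_gt0// ha.
apply: continuousM; last exact: cst_continuous.
apply: continuousM; first exact: cst_continuous.
apply: (@continuous_comp _ _ _ (fun y : 'rV[R]_m => y 0 i)
  (fun r : R => r ^+ 2)).
  exact: coord_continuous.
exact: exprn_continuous.
Qed.

(** * Compactness of the sublevel sets *)

(** Continuity is required at the points of K only, in the ambient space, since
    the adherent points of the sublevel set are in K. *)
Lemma closed_sublevel (R : realType) (T : topologicalType) (K : set T)
    (f : T -> R) (c : R) :
  closed K -> (forall x, K x -> {for x, continuous f}) ->
  closed (K `&` [set x | f x <= c]).
Proof.
move=> cK cf x clx.
have Kx : K x by apply: cK; apply: closure_subset clx => y [].
split=> //=; rewrite leNgt; apply/negP => cfx.
have [y [[_ /= fyc] /= /lt_geF]] := clx _ (cvgr_gt _ (cf x Kx) c cfx).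
by rewrite fyc.
Qed.

Lemma closed_xi_finB_ge (R : realType) (m : nat) (delta : nat -> R) :
  closed [set x : 'rV[R]_m |
    forall i, (i < m)%N -> delta i <= xi_fin x i - xi_fin x i.+1].
Proof.
rewrite (_ : mkset _ = \bigcap_(i in [set i | (i < m)%N])
    (fun x : 'rV[R]_m => xi_fin x i - xi_fin x i.+1) @^-1`
      [set r | delta i <= r]); last by [].
apply: closed_bigI => i _.
apply: (continuous_closedP _).1; last exact: closed_ge.
move=> x; apply: (@continuousB _ _ _ (xi_fin^~ i) (xi_fin^~ i.+1));
  exact: continuous_xi_fin.
Qed.

(** One of two terms is coercive in xi_1: the logarithmic term of index 0 if
    u_0 < u_1, and the quadratic term of index 1 otherwise. *)
Lemma xi_fin0_bounded (R : realType) (m : nat) (u a k d : nat -> R) (c : R) :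
  (0 < m)%N ->
  (forall j, (j <= m)%N -> 0 < a j) ->
  (forall j, (j <= m)%N -> 0 <= k j * (u j.+1 - u j)) ->
  (forall j, (1 <= j <= m)%N -> 0 <= d j) ->
  0 < k 0%N * (u 1%N - u 0%N) \/ 0 < d 1%N ->
  exists M, forall x : 'rV[R]_m, Omega_le u a k d c x -> xi_fin x 0 <= M.
Proof.
move=> m0 ha hw hd [w0|d1].
  have [M M0 FM] := @Freal_bounded_preimage R _
    (expR_gt0 (- (c / (k 0%N * (u 1%N - u 0%N))))).
  exists (M * a 0%N) => x Ox; rewrite -ler_pdivrMr ?ha//; apply: FM.
    by rewrite divr_ge0 ?(ltW (ha _ _))// Omega_xi_fin_ge0//; case: Ox.
  rewrite -gap0E ?ha//.
  exact: (gap_ge _ _ u a k d c x 0).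
exists (Num.sqrt (c * 4 / d 1%N)) => x Ox.
have x0 : 0 <= xi_fin x 0 by apply: Omega_xi_fin_ge0; case: Ox.
rewrite -[leLHS](ger0_norm x0) -sqrtr_sqr ler_wsqrtr//.
rewrite ler_pdivlMr// mulrC -ler_pdivrMr//; case: Ox => Ox; apply: le_trans.
exact: (quadratic_le_E _ _ _ _ _ _ _ 0%N).
Qed.

Lemma xi_fin_le0 (R : realType) (m : nat) (x : 'rV[R]_m) (i : nat) :
  Omega x -> (i < m)%N -> xi_fin x i <= xi_fin x 0.
Proof.
move/OmegaP => xlt; elim: i => // i IH im.
by apply: le_trans (IH (ltnW im)); apply/ltW/xlt/ltnW.
Qed.

(** The set K cut out by the positive lower bounds on the differences of
    coordinates is closed in the whole space and contained in [Omega], so no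
    limit point of the sublevel set is lost on the boundary of [Omega]. *)
Lemma compact_Omega_le (R : realType) (m : nat) (u a k d : nat -> R) (c : R) :
  (0 < m)%N ->
  (forall j, (j <= m)%N -> 0 < a j) ->
  (forall j, (j <= m)%N -> 0 <= k j * (u j.+1 - u j)) ->
  (forall j, (1 <= j <= m)%N -> 0 < k j * (u j.+1 - u j)) ->
  (forall j, (1 <= j <= m)%N -> 0 <= d j) ->
  0 < k 0%N * (u 1%N - u 0%N) \/ 0 < d 1%N ->
  compact (@Omega_le R m u a k d c).
Proof.
move=> m0 ha hw hw1 hd hw0d1.
pose delta (i : nat) : R := Num.sqrt pi * a i.+1 *
  expR (- (c / (k i.+1 * (u i.+2 - u i.+1)))).
pose K := [set x : 'rV[R]_m |
  forall i, (i < m)%N -> delta i <= xi_fin x i - xi_fin x i.+1].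
have KO x : K x -> Omega x.
  move=> Kx; apply/OmegaP => i im; rewrite -subr_gt0.
  apply: lt_le_trans (Kx i im).
  by rewrite mulr_gt0 ?expR_gt0// mulr_gt0 ?ha// sqrtr_gt0 pi_gt0.
have OK x : Omega_le u a k d c x -> K x.
  move=> Ox i im; apply: le_trans (gap_le_xi_finB _ _ _ _ _ Ox.1 im (ha _ im)).
  rewrite ler_pM2l ?mulr_gt0 ?ha// ?sqrtr_gt0 ?pi_gt0//.
  exact: (gap_ge _ _ u a k d c x i.+1 ha hw hd Ox im (hw1 i.+1 im)).
have [M xM] := xi_fin0_bounded R m u a k d c m0 ha hw hd hw0d1.
apply: (@subclosed_compact _ _
  [set x : 'rV[R]_m | forall i, `[0, M]%classic (x 0 i)]).
- rewrite (_ : Omega_le _ _ _ _ _ = K `&` [set x | E u a k d x <= c]).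
    apply: (@closed_sublevel R _ K (E u a k d) c).
      exact: closed_xi_finB_ge.
    by move=> x /KO; exact: continuous_E.
  apply/seteqP; split=> [x Ox|x [/KO]//].
  by split; [exact: OK|case: Ox].
- apply: (@rV_compact R m (fun=> `[0, M]%classic)) => i.
  exact: segment_compact.
- move=> x Ox i; have := xM x Ox; case: Ox => Ox _ x0M.
  rewrite /= in_itv/= -xi_fin_ord Omega_xi_fin_ge0//=.
  exact/(le_trans _ x0M)/xi_fin_le0.
Qed.

Lemma Omega_nonempty (R : realType) (m : nat) :
  Omega (\row_(i < m) (m - i)%:R : 'rV[R]_m).
Proof.
split=> [i j ij|i]; rewrite !mxE; last by rewrite ltr0n subn_gt0.
by rewrite ltr_nat ltn_sub2l.
Qed.

Theorem proposition1p1 (R : realType) (m : nat) (u a k d : nat -> R)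
  (hm : (1 <= m)%N)
  (hu0 : u 0%N <= u 1%N)
  (hu : forall i : nat, (1 <= i <= m)%N -> u i < u i.+1)
  (ha : forall i : nat, (i <= m)%N -> 0 < a i)
  (hk : forall i : nat, (i <= m)%N -> 0 < k i)
  (hd : forall i : nat, (1 <= i <= m)%N -> 0 <= d i)
  (hd1 : u 0%N = u 1%N -> 0 < d 1%N) :
  (forall c : R, 0 < c -> compact (@Omega_le R m u a k d c)) /\
  (exists2 x : 'rV[R]_m, Omega x &
     forall y : 'rV[R]_m, Omega y -> E u a k d x <= E u a k d y).
Proof.
have hw1 j : (1 <= j <= m)%N -> 0 < k j * (u j.+1 - u j).
  by move=> /[dup] /andP[_ jm] j1m; rewrite mulr_gt0 ?hk// subr_gt0 hu.
have hw j : (j <= m)%N -> 0 <= k j * (u j.+1 - u j).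
  case: j => [|j] jm; last by apply/ltW/hw1.
  by rewrite mulr_ge0 ?subr_ge0// ltW// hk.
have hw0d1 : 0 < k 0%N * (u 1%N - u 0%N) \/ 0 < d 1%N.
  move: hu0; rewrite le_eqVlt => /predU1P[/hd1|u01]; first by right.
  by left; rewrite mulr_gt0 ?hk// subr_gt0.
have cO c : compact (@Omega_le R m u a k d c) by exact: compact_Omega_le.
split=> [c _ //|].
pose x0 : 'rV[R]_m := \row_(i < m) (m - i)%:R.
have Ox0 : Omega x0 := Omega_nonempty R m.
have ne : @Omega_le R m u a k d (E u a k d x0) !=set0 by exists x0.
have [|x] := @EVT_min_rV R m (E u a k d) _ ne (cO _).
  by apply: continuous_in_subspaceT => x /set_mem[Ox _]; exact: continuous_E.
rewrite inE => -[Ox Ex] xmin; exists x => // y Oy.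
have [yx0|/ltW x0y] := leP (E u a k d y) (E u a k d x0).
  by apply: xmin; rewrite inE.
exact: le_trans x0y.
Qed.
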